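(* Let $X$ be the Markov mixture process on $\mathbb{S}=\{1,\dots,n+1\}$ with intensity matrices $\mathbf{Q}^{(1)},\dots,\mathbf{Q}^{(m)}$. For any $s\ge t\ge0$, the conditional transition probability matrix $[\mathbf{P}(t,s)]_{i,j}:=\mathbb{P}\{X_s=j\mid\mathcal{F}_{t,i}\}$, $i,j\in\mathbb{S}$, is given by $$\mathbf{P}(t,s)=\sum_{k=1}^m\widetilde{\mathbf{S}}^{(k)}(t)\,e^{\mathbf{Q}^{(k)}(s-t)},\qquad\text{with}\quad\sum_{k=1}^m\widetilde{\mathbf{S}}^{(k)}(t)=\mathbf{I}.$$
   Context: Mixture process: $\mathbb{S}=\{1,\dots,n+1\}$ is finite and $\mathbf{Q}^{(1)},\dots,\mathbf{Q}^{(m)}$ are intensity matrices on $\mathbb{S}$ (nonnegative off-diagonal entries, zero row sums). On a probability space there are an unobserved regime $\phi\in\{1,\dots,m\}$ and an $\mathbb{S}$-valued right-continuous process $X=(X_t)_{t\ge0}$ such that $\mathbb{P}\{X_0=i\}=\widetilde\pi_i$, $\mathbb{P}\{\phi=k\mid X_0=i\}=s_i^{(k)}$ with $\sum_k s_i^{(k)}=1$, and, given $\phi=k$ and $X_0=i$, $X$ is a time-homogeneous Markov jump process with intensity matrix $\mathbf{Q}^{(k)}$ started at $i$. Information: $\mathcal{F}_{t-}$ is any sub-$\sigma$-field of $\sigma(X_s:0\le s<t)$ (full, partial, or no information on the past), and $\mathcal{F}_{t,i}$ denotes $\mathcal{F}_{t-}$ together with $X_t=i$. That is, for an event $A$, $\mathbb{P}\{A\mid\mathcal{F}_{t,i}\}:=\mathbb{P}\{A\cap\{X_t=i\}\mid\mathcal{F}_{t-}\}/\mathbb{P}\{X_t=i\mid\mathcal{F}_{t-}\}$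 where the denominator is positive; identities for row $i$ are understood almost surely there. The updated switching probabilities are $s_i^{(k)}(t)=\mathbb{P}\{\phi=k\mid\mathcal{F}_{t,i}\}$ (completed arbitrarily to nonnegative weights with $\sum_k s_i^{(k)}(t)=1$ where undefined), and $\widetilde{\mathbf{S}}^{(k)}(t)=\mathrm{diag}(s_1^{(k)}(t),\dots,s_{n+1}^{(k)}(t))$. $\mathbf{I}$ is the identity matrix. *)

(* Defs.v *)
From HB Require Import structures.
From mathcomp Require Import all_boot all_order all_algebra.
From mathcomp Require Import all_classical all_reals all_analysis.
Set Implicit Arguments.
Unset Strict Implicit.
Unset Printing Implicit Defensive.
Import Order.TTheory GRing.Theory Num.Theory.
Import numFieldNormedType.Exports.
Local Open Scope classical_set_scope.
Local Open Scope ring_scope.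

(* The (n+1)-point state space is 'I_n.+1 and the set of the m regimes is     *)
(* 'I_m. A process X : R -> T -> 'I_n.+1 is indexed by the whole line, but    *)
(* only its values at nonnegative times are ever constrained or used.         *)

Section MatrixExponential.
Context {R : realType} {n : nat}.

Definition expmx (A : 'M[R]_n.+1) : 'M[R]_n.+1 :=
  limn (series (fun k : nat => (k`!%:R : R)^-1 *: A ^+ k)).

Definition intensity_matrix (Q : 'M[R]_n.+1) : Prop :=
  (forall i j, i != j -> 0 <= Q i j) /\ (forall i, \sum_j Q i j = 0).

(* Q enters only through the jump rates p h i j = (i == j) + h * Q i j + o(h) *)
(* as h -> 0+; that p u = expmx (u *: Q) is not part of the definition.       *)
Record transition_function (Q : 'M[R]_n.+1) (p : R -> 'M[R]_n.+1) : Prop := {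
  transition_ge0 : forall u, 0 <= u -> forall i j, 0 <= p u i j ;
  transition_sum1 : forall u, 0 <= u -> forall i, \sum_j p u i j = 1 ;
  transition_0 : p 0 = 1%:M ;
  transitionD : forall u v, 0 <= u -> 0 <= v -> p (u + v) = p u *m p v ;
  transition_rate : h^-1 *: (p h - 1%:M) @[h --> 0^'+] --> Q }.

End MatrixExponential.

Section Conditioning.
Context {d : measure_display} {T : measurableType d} {R : realType}.
Variable P : probability T R.

Definition cprob (D A : set T) : R := fine (P (A `&` D)) / fine (P D).

(* f is a version of the conditional probability of A given the sub-sigma-    *)
(* algebra F.                                                                 *)
Definition cprob_version (F : set (set T)) (A : set T) (f : T -> R) : Prop :=
  [/\ preimage_set_system setT f measurable `<=` F,
      P.-integrable setT (EFin \o f) &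
      forall B, F B -> (\int[P]_(w in B) (f w)%:E = P (A `&` B))%E ].

End Conditioning.

Section MixtureProcess.
Context {d : measure_display} {T : measurableType d} {R : realType}.
Variable P : probability T R.
Context {n m : nat}.

Definition sigma_process (X : R -> T -> 'I_n.+1) (I : set R) : set (set T) :=
  <<s [set X u @^-1` [set i] | u in I & i in [set: 'I_n.+1]] >>.

(* Under P( . | D), X has the time-homogeneous Markov property with respect   *)
(* to its natural filtration, P(X_(t+h) = j | X_u, u <= t) = p h (X_t) j,     *)
(* integrated over the events B `&` [X_t = i] with B in the past up to t.     *)
Definition markov_jump_given (D : set T) (Q : 'M[R]_n.+1)
    (X : R -> T -> 'I_n.+1) : Prop :=
  exists p : R -> 'M[R]_n.+1, transition_function Q p /\
    forall t h, 0 <= t -> 0 <= h ->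
    forall B, sigma_process X `[0, t]%classic B -> forall i j,
      cprob P D (B `&` X t @^-1` [set i] `&` X (t + h) @^-1` [set j]) =
      cprob P D (B `&` X t @^-1` [set i]) * p h i j.

Record mixture_process (Q : 'I_m -> 'M[R]_n.+1) (pi0 : 'I_n.+1 -> R)
    (s0 : 'I_m -> 'I_n.+1 -> R) (phi : T -> 'I_m) (X : R -> T -> 'I_n.+1) :
    Prop := {
  regime_measurable : forall k, measurable (phi @^-1` [set k]) ;
  state_measurable :
    forall t, 0 <= t -> forall i, measurable (X t @^-1` [set i]) ;
  right_continuous_paths :
    forall w t, 0 <= t -> \forall s \near t^'+, X s w = X t w ;
  initial_law : forall i, P (X 0 @^-1` [set i]) = (pi0 i)%:E ;
  regime_law : forall k i, P (X 0 @^-1` [set i]) != 0%E ->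
    cprob P (X 0 @^-1` [set i]) (phi @^-1` [set k]) = s0 k i ;
  regime_law_sum1 : forall i, \sum_k s0 k i = 1 ;
  regime_markov : forall k i,
    let D := phi @^-1` [set k] `&` X 0 @^-1` [set i] in
    P D != 0%E -> markov_jump_given D (Q k) X }.

End MixtureProcess.

Section UpdatedMatrices.
Context {T : Type} {R : realType} {n m : nat}.

(* pX i, pXX i j and pphiX k i are versions of the conditional probabilities, *)
(* given the information F before t, of [X_t = i], [X_s = j, X_t = i] and     *)
(* [phi = k, X_t = i] respectively. Row i is meaningful where 0 < pX i w.     *)

Definition cond_transition_mx (pX : 'I_n.+1 -> T -> R)
    (pXX : 'I_n.+1 -> 'I_n.+1 -> T -> R) (w : T) : 'M[R]_n.+1 :=
  \matrix_(i, j) (pXX i j w / pX i w).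

Definition switching_mx (S : 'I_m -> 'I_n.+1 -> T -> R) (k : 'I_m) (w : T) :
    'M[R]_n.+1 :=
  diag_mx (\row_i S k i w).

(* Switching probabilities P(phi = k | F, X_t = i), completed by arbitrary    *)
(* weights where the conditioning is undefined.                               *)
Definition updated_switching (pX : 'I_n.+1 -> T -> R)
    (pphiX S : 'I_m -> 'I_n.+1 -> T -> R) : Prop :=
  forall i w,
    (0 < pX i w -> forall k, S k i w = pphiX k i w / pX i w) /\
    (pX i w <= 0 -> (forall k, 0 <= S k i w) /\ \sum_k S k i w = 1).

End UpdatedMatrices.

(* Main.v *)
(* Within regime k the transition function p satisfies p u = p (u / N) ^ N =
   (1 + (u / N) Q + o(1 / N)) ^ N, hence p u = exp (u Q). For B in F, summing the
   Markov property at t over the regimes and the initial states gives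
     P(X_s = j, X_t = i, B) = sum_k exp((s - t) Q_k)_ij P(phi = k, X_t = i, B),
   so both sides of the identity, multiplied by P(X_t = i | F), are F-measurable
   with equal integrals over every B in F, hence almost surely equal. *)
Require Import Defs.
From HB Require Import structures.
From mathcomp Require Import all_boot all_order all_algebra.
From mathcomp Require Import all_classical all_reals all_analysis.
Import Order.TTheory GRing.Theory Num.Theory.
Import numFieldNormedType.Exports.
Local Open Scope classical_set_scope.
Local Open Scope ring_scope.
From mathcomp Require Import measurable_realfun ring.
Set Implicit Arguments.
Unset Strict Implicit.
Unset Printing Implicit Defensive.

(** The norm bound $\|A\|_\infty\le c$ for the maximum absolute row sum, kept as a predicate so that
    no maximum is formed. Stochastic matrices satisfy it with [c = 1]. *)
Definition row_sums_le {R : numDomainType} {n : nat} (c : R) (A : 'M[R]_n) :=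
  forall i, \sum_j `|A i j| <= c.

Lemma ffact_leX (n m : nat) : (n ^_ m <= n ^ m)%N.
Proof.
elim: m => [|m IH]; first by rewrite ffactn0.
by rewrite ffactnSr expnSr leq_mul// leq_subr.
Qed.

(** * Maximum row-sum norm of matrices *)

Section RowSums.
Context {R : numDomainType} {n : nat}.
Implicit Types (A B : 'M[R]_n.+1) (a b c e M : R).

Lemma row_sums_le_ge0 c A : row_sums_le c A -> 0 <= c.
Proof. by move=> /(_ ord0); apply: le_trans; exact: sumr_ge0. Qed.

Lemma row_sums_le_entry c A i j : row_sums_le c A -> `|A i j| <= c.
Proof.
move=> /(_ i); apply: le_trans.
by rewrite (bigD1 j)//= lerDl sumr_ge0.
Qed.

Lemma row_sums_leD a b A B :
  row_sums_le a A -> row_sums_le b B -> row_sums_le (a + b) (A + B).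
Proof.
move=> hA hB i; apply: le_trans (lerD (hA i) (hB i)).
by rewrite -big_split/=; apply: ler_sum => j _; rewrite mxE ler_normD.
Qed.

Lemma row_sums_leM a b A B :
  row_sums_le a A -> row_sums_le b B -> row_sums_le (a * b) (A * B).
Proof.
move=> hA hB i; have b0 := row_sums_le_ge0 hB.
apply: (@le_trans _ _ (\sum_l `|A i l| * \sum_j `|B l j|)).
  under [leRHS]eq_bigr do rewrite mulr_sumr.
  rewrite exchange_big/=; apply: ler_sum => j _; rewrite mxE.
  by apply: (le_trans (ler_norm_sum _ _ _)); apply: ler_sum => l _; rewrite normrM.
apply: (le_trans (ler_sum _ (fun l _ => ler_wpM2l (normr_ge0 _) (hB l)))).
by rewrite -mulr_suml ler_wpM2r.
Qed.

Lemma row_sums_le1 : row_sums_le 1 (1 : 'M[R]_n.+1).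
Proof.
move=> i; rewrite (bigD1 i)//= mxE eqxx normr1 big1 ?addr0// => j ji.
by rewrite mxE eq_sym (negPf ji) normr0.
Qed.

Lemma row_sums_leX a A k : row_sums_le a A -> row_sums_le (a ^+ k) (A ^+ k).
Proof.
move=> hA; elim: k => [|k IH]; first by rewrite !expr0; exact: row_sums_le1.
by rewrite !exprS; exact: row_sums_leM.
Qed.

(** Telescoping: $A^{k+1}-B^{k+1}=A(A^k-B^k)+(A-B)B^k$. Each step adds an error of at most $eM^k$,
    and $M\ge1$ allows the cruder exponent that keeps the induction uniform. *)
Lemma row_sums_le_subX M e A B k : 1 <= M ->
  row_sums_le M A -> row_sums_le M B -> row_sums_le e (A - B) ->
  row_sums_le (k%:R * e * M ^+ k) (A ^+ k - B ^+ k).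
Proof.
move=> M1 hA hB hAB; have e0 := row_sums_le_ge0 hAB.
have M0 : 0 <= M by exact: le_trans ler01 M1.
elim: k => [|k IH].
  by move=> i; rewrite !expr0 subrr mul0r mul0r big1// => j _; rewrite mxE normr0.
have -> : A ^+ k.+1 - B ^+ k.+1 = A * (A ^+ k - B ^+ k) + (A - B) * B ^+ k.
  by rewrite mulrBr mulrBl -!exprS addrA subrK.
move=> i; have hsum := row_sums_leD (row_sums_leM hA IH)
  (row_sums_leM hAB (row_sums_leX k hB)).
apply: le_trans (hsum i) _.
rewrite mulrCA -exprS [in leRHS]mulrSr !mulrDl mul1r lerD2l.
by rewrite ler_wpM2l// exprS ler_peMl// exprn_ge0.
Qed.

End RowSums.

(** * Compound powers against partial sums of the exponential series *)

Section Exponential.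
Context {R : realType}.

Lemma series_exp_coeff_le_expR (c : R) N : 0 <= c ->
  series (exp_coeff c) N <= expR c.
Proof.
move=> c0; apply: nondecreasing_cvgn_le; last exact: is_cvg_series_exp_coeff.
by apply: nondecreasing_series => k _ _; exact: exp_coeff_ge0.
Qed.

(* From [1 / (1 + c / x) = 1 - c / (x + c) <= exp (- c / (x + c))]. *)
Lemma expR_le_1Ddiv (c x : R) : 0 <= c -> 0 < x ->
  expR (c / (x + c)) <= 1 + c / x.
Proof.
move=> c0 x0; have xc0 : 0 < x + c by rewrite ltr_wpDr.
rewrite -[leLHS]invrK -expRN invf_ple ?posrE ?expR_gt0//; last first.
  by rewrite ltr_wpDr// divr_ge0// ltW.
apply: le_trans (expR_ge1Dx _).
have -> : 1 + c / x = (x + c) / x by field; rewrite gt_eqF.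
have -> : 1 - c / (x + c) = x / (x + c) by field; rewrite gt_eqF.
by rewrite invf_div.
Qed.

(** With $x=N+1$, the $x$-th power of the previous bound gives $(1+c/x)^x\ge
    e^{cx/(x+c)}=e^{c-c^2/(x+c)}\ge e^c e^{-c^2/x}$, and $e^{-y}\ge1-y$ finishes. *)
Lemma expR_le_compound (c : R) (N : nat) : 0 <= c ->
  expR c * (1 - c ^+ 2 / N.+1%:R) <= (1 + c / N.+1%:R) ^+ N.+1.
Proof.
move=> c0; have : (0 : R) < N.+1%:R by rewrite ltr0n.
have := @expRM_natr R N.+1; move: (N.+1%:R : R) => x expRM x0.
have xc0 : 0 < x + c by rewrite ltr_wpDr.
apply: (@le_trans _ _ (expR (c / (x + c)) ^+ N.+1)); last first.
  rewrite lerXn2r ?expR_le_1Ddiv// nnegrE ?expR_ge0//.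
  by rewrite addr_ge0// divr_ge0// ltW.
rewrite -expRM; apply: (@le_trans _ _ (expR c * expR (- (c ^+ 2 / x)))).
  by rewrite ler_wpM2l ?expR_ge0// expR_ge1Dx.
rewrite -expRD ler_expR.
have -> : c / (x + c) * x = c - c ^+ 2 / (x + c) by field; rewrite gt_eqF.
rewrite lerD2l lerN2 ler_wpM2l ?sqr_ge0// lef_pV2 ?posrE//.
by rewrite lerDl.
Qed.

(** Both terms are polynomials in [A] of degree $N+1$, and each coefficient of the power is at most
    the matching $1/k!$. The differences being nonnegative, the matrix error is dominated by the
    scalar error at [c], which [expR_le_compound] bounds. *)
Lemma series_expmx_dist (n : nat) (A : 'M[R]_n.+1) (c : R) (N : nat) i j :
  row_sums_le c A ->
  `|(series (fun k : nat => (k`!%:R : R)^-1 *: A ^+ k) N.+2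
     - (1 + N.+1%:R^-1 *: A) ^+ N.+1) i j| <= expR c * c ^+ 2 / N.+1%:R.
Proof.
move=> hA; have c0 := row_sums_le_ge0 hA.
pose q k : R := N.+1%:R^-1 ^+ k *+ 'C(N.+1, k).
(* $\binom{N+1}{k}\,k!$ is a falling factorial, at most $(N+1)^k$. *)
have q_le k : q k <= (k`!%:R)^-1.
  rewrite /q exprVn -mulr_natr mulrC ler_pdivrMr ?exprn_gt0 ?ltr0n//.
  rewrite mulrC ler_pdivlMr ?ltr0n ?fact_gt0//.
  by rewrite -natrM bin_ffact -natrX ler_nat ffact_leX.
have -> : (1 + N.+1%:R^-1 *: A) ^+ N.+1 = \sum_(k < N.+2) q k *: A ^+ k.
  rewrite addrC exprD1n; apply: eq_bigr => k _.
  by rewrite exprZn scalerMnl.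
rewrite /series/= big_mkord -sumrB summxE.
apply: (le_trans (ler_norm_sum _ _ _)).
apply: (@le_trans _ _ (\sum_(k < N.+2) ((k`!%:R)^-1 - q k) * c ^+ k)).
  apply: ler_sum => k _; rewrite -scalerBl mxE normrM ger0_norm ?subr_ge0//.
  by rewrite ler_wpM2l ?subr_ge0// row_sums_le_entry//; exact: row_sums_leX.
under eq_bigr do rewrite mulrBl.
rewrite sumrB.
have -> : \sum_(k < N.+2) q k * c ^+ k = (1 + c / N.+1%:R) ^+ N.+1.
  rewrite addrC exprD1n; apply: eq_bigr => k _.
  by rewrite exprMn mulrC mulrnAr.
have -> : \sum_(k < N.+2) (k`!%:R)^-1 * c ^+ k = series (exp_coeff c) N.+2.
  by rewrite /series/= big_mkord exp_coeffE.
rewrite lerBlDr; apply: (le_trans (series_exp_coeff_le_expR _ c0)).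
rewrite -lerBlDl; apply: le_trans (expR_le_compound N c0).
by rewrite -mulrA mulrBr mulr1.
Qed.

End Exponential.

(** * Transition functions are matrix exponentials *)

Section TransitionFunction.
Context {R : realType} {n : nat}.
Implicit Types (Q : 'M[R]_n.+1) (p : R -> 'M[R]_n.+1).

Lemma transition_function_natM Q p u k :
  transition_function Q p -> 0 <= u -> p (k%:R * u) = p u ^+ k.
Proof.
move=> hp u0; elim: k => [|k IH]; first by rewrite mul0r (transition_0 hp).
by rewrite mulrSr mulrDl mul1r (transitionD hp)// ?mulr_ge0// IH exprSr.
Qed.

Lemma row_sums_le_transition Q p u :
  transition_function Q p -> 0 <= u -> row_sums_le 1 (p u).
Proof.
move=> hp u0 i; rewrite -(transition_sum1 hp u0 i).
by apply: ler_sum => j _; rewrite ger0_norm// (transition_ge0 hp).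
Qed.

(** The entrywise limit is made uniform over the finitely many entries: an error below $e/(n+1)$ in
    each of the $n+1$ entries of a row sums to at most $e$. *)
Lemma transition_function_rate Q p e : transition_function Q p -> 0 < e ->
  \forall h \near 0^'+, row_sums_le (h * e) (p h - (1 + h *: Q)).
Proof.
move=> hp e0; have e'0 : 0 < e / n.+1%:R by rewrite divr_gt0.
have : \forall h \near 0^'+, forall i, forall j,
    `|Q i j - (h^-1 *: (p h - 1%:M)) i j| < e / n.+1%:R.
  apply: filter_forall => i; apply: filter_forall => j.
  have hij : (h^-1 *: (p h - 1%:M)) i j @[h --> 0^'+] --> Q i j.
    exact: (continuous_cvg _ (@coord_continuous R _ _ i j Q) (transition_rate hp)).
  by move/cvgrPdist_lt: hij; exact.
apply: filterS2 (nbhs_right_gt 0) => h h0 hh.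
move=> i; apply: (@le_trans _ _ (\sum_(j < n.+1) h * (e / n.+1%:R))).
  apply: ler_sum => j _.
  have -> : (p h - (1 + h *: Q)) i j = - h * (Q i j - (h^-1 *: (p h - 1%:M)) i j).
    by rewrite !mxE; field; rewrite gt_eqF.
  by rewrite normrM normrN (gtr0_norm h0) ler_wpM2l ?ltW.
by rewrite sumr_const card_ord -(mulr_natr (h * _)) -mulrA divfK// pnatr_eq0.
Qed.

(* [p u = p (u / N) ^ N] is compared with [(1 + (u / N) Q) ^ N], which in turn
   is compared with the partial sums of the exponential series. *)
Lemma transition_function_expmx Q p u :
  transition_function Q p -> 0 <= u -> expmx (u *: Q) = p u.
Proof.
move=> hp u0; apply: cvg_lim; first exact: norm_hausdorff.
pose c := \sum_i \sum_j `|(u *: Q) i j|.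
have hc : row_sums_le c (u *: Q).
  by move=> i; rewrite /c [leRHS](bigD1 i)//= lerDl sumr_ge0// => *; rewrite sumr_ge0.
have c0 := row_sums_le_ge0 hc.
(* The shift by 2 aligns the partial sum with $N+2$ terms and the power $N+1$. *)
rewrite -(cvg_shiftn 2); apply/cvg_ballP => e e0.
(* Chosen so that the accumulated error $u\,e'\,e^c$ is at most $e/2$; $u+1$ keeps the divisor
   positive when $u=0$. *)
pose e' := e / 2 / (u + 1) / expR c.
have e'0 : 0 < e' by rewrite !divr_gt0 ?expR_gt0// ltr_wpDl.
have hN : \forall N \near \oo,
    row_sums_le (u / N.+1%:R * e') (p (u / N.+1%:R) - (1 + N.+1%:R^-1 *: (u *: Q))).
  (* The rate at $0^+$ says nothing about $h=0$, so $u=0$ is treated apart; there the difference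
     vanishes. *)
  move: u0; rewrite le_eqVlt => /predU1P[<-|u_gt0].
    apply: nearW => N i.
    rewrite !mul0r (transition_0 hp) scale0r scaler0 addr0 subrr.
    by rewrite big1// => j _; rewrite mxE normr0.
  have [/= d d0 hd] : \forall h \near 0, 0 < h ->
    row_sums_le (h * e') (p h - (1 + h *: Q)) by exact: (transition_function_rate hp e'0).
  have du0 : 0 < d / u by rewrite divr_gt0.
  apply: filterS (near_infty_natSinv_lt (PosNum du0)) => N /= Nd.
  rewrite scalerA [_^-1 * u]mulrC; apply: hd; last by rewrite divr_gt0.
  by rewrite /= sub0r normrN gtr0_norm ?divr_gt0// mulrC -ltr_pdivlMr.
have e''0 : 0 < e / 2 / (expR c * c ^+ 2 + 1).
  by rewrite !divr_gt0// ltr_wpDl// mulr_ge0// ?expR_ge0 ?sqr_ge0.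
apply: filterS2 hN (near_infty_natSinv_lt (PosNum e''0)) => N hN /= Ne.
split=> // i j; rewrite -ball_normE /= addn2 distrC.
set B := 1 + _ in hN; set h := u / _ in hN; set s := series _ _.
have h0 : 0 <= h by rewrite divr_ge0.
have -> : s i j - p u i j =
    (s - B ^+ N.+1) i j + - (p h ^+ N.+1 - B ^+ N.+1) i j.
  have -> : p u = p h ^+ N.+1.
    by rewrite -(transition_function_natM _ hp h0) mulrC divfK// pnatr_eq0.
  by rewrite !mxE; ring.
apply: (le_lt_trans (ler_normD _ _)); rewrite normrN [ltRHS]splitr.
apply: ltr_leD.
  apply: (le_lt_trans (series_expmx_dist N i j hc)).
  apply: (@le_lt_trans _ _ ((expR c * c ^+ 2 + 1) / N.+1%:R)).
    by rewrite ler_wpM2r// lerDl.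
  rewrite mulrC -ltr_pdivlMr// ltr_wpDl// mulr_ge0// ?expR_ge0 ?sqr_ge0//.
(* [B] and [p h] share the bound $M=1+c/(N+1)$, and $M^{N+1}\le e^c$ stays bounded in $N$, so $N+1$
   one-step errors $h\,e'$ add up to at most $u\,e'\,e^c$. *)
have hB : row_sums_le (1 + c / N.+1%:R) B.
  apply: row_sums_leD; first exact: row_sums_le1.
  move=> k; under eq_bigr do rewrite mxE normrM.
  by rewrite -mulr_sumr ger0_norm// mulrC ler_wpM2r.
have M1 : 1 <= 1 + c / N.+1%:R by rewrite lerDl divr_ge0.
have hA : row_sums_le (1 + c / N.+1%:R) (p h).
  by move=> k; apply: le_trans M1; exact: (row_sums_le_transition hp h0).
apply: (le_trans (row_sums_le_entry i j (row_sums_le_subX N.+1 M1 hA hB hN))).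
have -> : N.+1%:R * (h * e') = u * e'.
  by rewrite mulrA; congr (_ * _); rewrite /h mulrC divfK// pnatr_eq0.
have MN : (1 + c / N.+1%:R) ^+ N.+1 <= expR c.
  have -> : expR c = expR (c / N.+1%:R) ^+ N.+1.
    by rewrite -expRM_natr divfK// pnatr_eq0.
  by rewrite lerXn2r ?expR_ge1Dx// nnegrE ?expR_ge0// (le_trans ler01).
apply: (@le_trans _ _ (u * e' * expR c)).
  by rewrite ler_wpM2l// mulr_ge0// ltW.
rewrite /e' -mulrA divfK ?gt_eqF ?expR_gt0// mulrA ler_pdivrMr ?ltr_wpDl//.
by rewrite mulrC ler_wpM2l ?lerDl// ltW// divr_gt0.
Qed.

End TransitionFunction.

(** * Almost sure uniqueness of conditional probabilities *)

Section SubSigmaAlgebra.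
Context {d : measure_display} {T : measurableType d} {R : realType}.
Variable P : probability T R.

Lemma measure_fibers (I : finType) (f : T -> I) (E : set T) :
  (forall i, measurable (f @^-1` [set i])) -> measurable E ->
  P E = (\sum_i P (E `&` f @^-1` [set i]))%E.
Proof.
move=> mf mE; have {1}-> : E = \bigcup_(i in [set: I]) (E `&` f @^-1` [set i]).
  by apply/seteqP; split=> [w Ew|w [i _ []//]]; exists (f w).
rewrite measure_fin_bigcup//=; last 2 first.
- by move=> i j _ _ [w [[_ <-] [_ <-]]].
- by move=> i _; exact: measurableI.
rewrite (fsbig_seq _ _ (index_enum_uniq I)).
by apply: eq_fsbigl; apply/seteqP; split=> // i _; rewrite /= mem_index_enum.
Qed.

Variable F : set (set T).
Hypothesis sigmaF : sigma_algebra setT F.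
Hypothesis measF : F `<=` measurable.

(** Generating from a $\sigma$-algebra adds no sets, so [F]-measurability can be handled as
    measurability on [g_sigma_algebraType F]. *)
Let measurableE B : measurable (B : set (g_sigma_algebraType F)) = F B.
Proof. by rewrite -[in RHS](sigma_algebra_id sigmaF). Qed.

(** The set $\{g<f\}$ lies in [F], so the integral of $f-g$ over it is zero; the integrand is
    positive there, hence the set is null. *)
Lemma ae_le_sub_sigma (f g : T -> R) :
  measurable_fun [set: g_sigma_algebraType F] f ->
  measurable_fun [set: g_sigma_algebraType F] g ->
  P.-integrable setT (EFin \o f) -> P.-integrable setT (EFin \o g) ->
  (forall B, F B -> \int[P]_(w in B) (f w)%:E = \int[P]_(w in B) (g w)%:E)%E ->
  {ae P, forall w, f w <= g w}.
Proof.
move=> mf mg intf intg fg; pose B := [set w | g w < f w].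
have FB : F B.
  rewrite -measurableE -[B]setTI.
  exact: (measurable_fun_ltr mg mf) (I : measurable [set true]).
have mB := measF FB.
have intfB : P.-integrable B (EFin \o f) by exact: integrableS intf.
have intgB : P.-integrable B (EFin \o g) by exact: integrableS intg.
have mfg := emeasurable_funB (measurable_int P intfB) (measurable_int P intgB).
have : (\int[P]_(w in B) `|(f w)%:E - (g w)%:E| = 0)%E.
  rewrite (eq_integral (fun w => (f w)%:E - (g w)%:E)%E); last first.
    move=> w; rewrite inE => Bw.
    by rewrite gee0_abs// -EFinB lee_fin subr_ge0 ltW.
  by rewrite integralB_EFin// fg// subee// integrable_fin_num.
move=> /(ae_eq_integral_abs P mB mfg); apply: filterS => w /= H.
rewrite leNgt; apply/negP => Bw; have := H Bw.
by move/eqP; rewrite -EFinB eqe subr_eq0 gt_eqF.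
Qed.

Lemma ae_eq_sub_sigma (f g : T -> R) :
  measurable_fun [set: g_sigma_algebraType F] f ->
  measurable_fun [set: g_sigma_algebraType F] g ->
  P.-integrable setT (EFin \o f) -> P.-integrable setT (EFin \o g) ->
  (forall B, F B -> \int[P]_(w in B) (f w)%:E = \int[P]_(w in B) (g w)%:E)%E ->
  {ae P, forall w, f w = g w}.
Proof.
move=> mf mg intf intg fg.
apply: filterS2 (ae_le_sub_sigma mf mg intf intg fg)
  (ae_le_sub_sigma mg mf intg intf (fun B FB => esym (fg B FB))) => w fw gw.
by apply/eqP; rewrite eq_le fw gw.
Qed.

Lemma cprob_version_measurable A f : cprob_version P F A f ->
  measurable_fun [set: g_sigma_algebraType F] f.
Proof. by case=> mf _ _ _ Y mY; rewrite measurableE; apply: mf; exists Y. Qed.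

(** Transfers a linear relation between measures on [F] to their conditional probabilities. It
    serves twice below: with entries of the exponentials as coefficients, and with all coefficients
    1. *)
Lemma cprob_version_sum (I : finType) (A0 : set T) (A : I -> set T)
    (f0 : T -> R) (f : I -> T -> R) (c : I -> R) :
  cprob_version P F A0 f0 -> (forall k, cprob_version P F (A k) (f k)) ->
  (forall B, F B -> P (A0 `&` B) = \sum_k (c k)%:E * P (A k `&` B))%E ->
  {ae P, forall w, f0 w = \sum_k c k * f k w}.
Proof.
move=> h0 h A0E; have [_ int0 f0E] := h0.
have intcf D : measurable D -> forall k,
    P.-integrable D (fun w => (c k)%:E * (f k w)%:E)%E.
  by move=> mD k; apply: integrableZl => //; have [_ + _] := h k; exact: integrableS.
have sumE w : (\sum_k c k * f k w)%:E = (\sum_k (c k)%:E * (f k w)%:E)%E.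
  by rewrite -sumEFin.
apply: ae_eq_sub_sigma => //.
- exact: cprob_version_measurable h0.
- apply: measurable_sum => k; apply: measurable_funM => //.
  exact: cprob_version_measurable (h k).
- rewrite /comp; under eq_fun do rewrite sumE.
  by apply: integrable_sum => // k _; exact: intcf.
move=> B FB; have mB := measF FB.
under [RHS]eq_integral do rewrite sumE.
rewrite integral_sum//; last by move=> k; exact: intcf.
rewrite f0E// A0E//; apply: eq_bigr => k _.
have [_ intf fE] := h k.
by rewrite integralZl ?fE//; exact: integrableS intf.
Qed.

End SubSigmaAlgebra.

(** * The Markov property integrated over past events *)

Section MixtureMarkov.
Context {d : measure_display} {T : measurableType d} {R : realType}.
Context {P : probability T R} {n m : nat}.
Context {Q : 'I_m -> 'M[R]_n.+1} {mu0 : 'I_n.+1 -> R}.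
Context {s0 : 'I_m -> 'I_n.+1 -> R} {phi : T -> 'I_m} {X : R -> T -> 'I_n.+1}.
Hypothesis hX : mixture_process P Q mu0 s0 phi X.

Lemma sigma_process_measurable (I : set R) :
  I `<=` [set u | 0 <= u] -> sigma_process X I `<=` measurable.
Proof.
move=> I0; apply: smallest_sub; first exact: sigma_algebra_measurable.
by move=> _ [u Iu [i _ <-]]; exact: (state_measurable hX (I0 _ Iu)).
Qed.

(** Multiplying the Markov property by $P(D)$ removes the conditioning, so the identity also covers
    null [D], where both sides are zero, and can be summed over all regimes and initial states. *)
Lemma regime_markov_expmx k l t h B i j : 0 <= t -> 0 <= h ->
  sigma_process X `[0, t] B ->
  let D := phi @^-1` [set k] `&` X 0 @^-1` [set l] in
  (P ((B `&` X t @^-1` [set i] `&` X (t + h) @^-1` [set j]) `&` D) =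
   (expmx (h *: Q k) i j)%:E * P ((B `&` X t @^-1` [set i]) `&` D))%E.
Proof.
move=> t0 h0 sB D; have th0 : 0 <= t + h by exact: addr_ge0.
have mB : measurable B.
  apply: sigma_process_measurable sB => u /=.
  by rewrite in_itv/= => /andP[].
have mD : measurable D.
  by apply: measurableI; [exact: (regime_measurable hX)|
    exact: (state_measurable hX (lexx 0))].
have mE : measurable (B `&` X t @^-1` [set i]).
  by apply: measurableI => //; exact: (state_measurable hX).
have mE' : measurable (B `&` X t @^-1` [set i] `&` X (t + h) @^-1` [set j]).
  by apply: measurableI => //; exact: (state_measurable hX).
have [PD0|PD0] := eqVneq (P D) 0%E.
  have PI0 A : measurable A -> P (A `&` D) = 0%E.
    by move=> mA; exact: (subset_measure0 (measurableI _ _ mA mD) mD).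
  by rewrite !PI0// mule0.
have [p [hp hM]] := regime_markov hX PD0.
have := hM t h t0 h0 B sB i j; rewrite /cprob -!/D.
rewrite (transition_function_expmx hp h0).
have fD : P D \is a fin_num by exact: fin_num_measure.
have fE : P (B `&` X t @^-1` [set i] `&` D) \is a fin_num.
  by apply: fin_num_measure; exact: measurableI.
have fE' : P ((B `&` X t @^-1` [set i] `&` X (t + h) @^-1` [set j]) `&` D)
    \is a fin_num.
  by apply: fin_num_measure; exact: measurableI.
rewrite -(fineK fE) -(fineK fE') -EFinM => eqE; congr (_%:E).
have fD0 : fine (P D) != 0 by rewrite fine_eq0.
by apply: (mulIf (invr_neq0 fD0)); rewrite eqE mulrC mulrA.
Qed.

(** The Markov property is given per regime and initial state, so both sides are split along both.
    The exponential depends on the regime only, hence factors out of the sum over initial states. *)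
Lemma mixture_markov_expmx t s B i j : 0 <= t -> t <= s ->
  sigma_process X `[0, t] B ->
  (P ((X s @^-1` [set j] `&` X t @^-1` [set i]) `&` B) =
   \sum_k (expmx ((s - t) *: Q k) i j)%:E *
     P ((phi @^-1` [set k] `&` X t @^-1` [set i]) `&` B))%E.
Proof.
move=> t0 ts sB.
have mX u l : 0 <= u -> measurable (X u @^-1` [set l]).
  by move=> u0; exact: (state_measurable hX).
have mphi := regime_measurable hX.
have mB : measurable B.
  apply: sigma_process_measurable sB => u /=.
  by rewrite in_itv/= => /andP[].
have s0' : 0 <= s by exact: le_trans ts.
have mE : measurable (B `&` X t @^-1` [set i]) by apply: measurableI => //; exact: mX.
have mE' : measurable (B `&` X t @^-1` [set i] `&` X s @^-1` [set j]).
  by apply: measurableI => //; exact: mX.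
have -> : X s @^-1` [set j] `&` X t @^-1` [set i] `&` B =
    B `&` X t @^-1` [set i] `&` X s @^-1` [set j].
  by rewrite setIC [X s @^-1` _ `&` _]setIC setIA.
rewrite (measure_fibers P mphi mE'); apply: eq_bigr => k _.
rewrite (measure_fibers P (fun l => mX 0 l (lexx 0)) (measurableI _ _ mE' (mphi k))).
have -> : phi @^-1` [set k] `&` X t @^-1` [set i] `&` B =
    B `&` X t @^-1` [set i] `&` phi @^-1` [set k].
  by rewrite setIC [phi @^-1` _ `&` _]setIC setIA.
rewrite (measure_fibers P (fun l => mX 0 l (lexx 0)) (measurableI _ _ mE (mphi k))).
rewrite ge0_sume_distrr//.
apply: eq_bigr => l _; rewrite -!(setIA _ (phi @^-1` _)).
have st0 : 0 <= s - t by rewrite subr_ge0.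
by have := regime_markov_expmx k l i j t0 st0 sB; rewrite /= subrKC.
Qed.

End MixtureMarkov.

Theorem theorem2p6 (R : realType) (d : measure_display) (T : measurableType d)
  (P : probability T R) (n m : nat) (Q : 'I_m -> 'M[R]_n.+1)
  (pi0 : 'I_n.+1 -> R) (s0 : 'I_m -> 'I_n.+1 -> R)
  (phi : T -> 'I_m) (X : R -> T -> 'I_n.+1)
  (hQ : forall k, intensity_matrix (Q k))
  (hX : mixture_process P Q pi0 s0 phi X)
  (t s : R) (ht : 0 <= t) (hts : t <= s)
  (F : set (set T)) (hF : sigma_algebra setT F)
  (hFX : F `<=` sigma_process X `[0, t[%classic)
  (pX : 'I_n.+1 -> T -> R)
  (hpX : forall i, cprob_version P F (X t @^-1` [set i]) (pX i))
  (pXX : 'I_n.+1 -> 'I_n.+1 -> T -> R)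
  (hpXX : forall i j,
     cprob_version P F (X s @^-1` [set j] `&` X t @^-1` [set i]) (pXX i j))
  (pphiX : 'I_m -> 'I_n.+1 -> T -> R)
  (hpphiX : forall k i,
     cprob_version P F (phi @^-1` [set k] `&` X t @^-1` [set i]) (pphiX k i))
  (S : 'I_m -> 'I_n.+1 -> T -> R)
  (hS : updated_switching pX pphiX S) :
  (forall i, {ae P, forall w, 0 < pX i w ->
     row i (cond_transition_mx pX pXX w) =
     row i (\sum_k switching_mx S k w *m expmx ((s - t) *: Q k))}) /\
  {ae P, forall w, \sum_k switching_mx S k w = 1%:M}.
Proof.
have measF : F `<=` measurable.
  apply: subset_trans hFX _; apply: (sigma_process_measurable hX) => u /=.
  by rewrite in_itv/= => /andP[].
have FX B : F B -> sigma_process X `[0, t] B.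
  move=> /hFX; apply: (sub_sigma_algebra2 (M := image2 _ _ _)) => /=.
  move=> _ [u + [i _ <-]]; rewrite /= in_itv/= => /andP[u0 /ltW ut].
  by exists u; [rewrite /= in_itv/= u0|exists i].
have pXXE : {ae P, forall w, forall i, forall j,
    pXX i j w = \sum_k expmx ((s - t) *: Q k) i j * pphiX k i w}.
  apply: filter_forall => i; apply: filter_forall => j.
  apply: (cprob_version_sum hF measF (hpXX i j) (hpphiX^~ i)) => B FB.
  exact: (mixture_markov_expmx hX _ _ ht hts (FX B FB)).
(* Total probability over the regimes; the factor 1 fits the shape of [cprob_version_sum]. *)
have pXE : {ae P, forall w, forall i, pX i w = \sum_k 1 * pphiX k i w}.
  apply: filter_forall => i.
  apply: (cprob_version_sum hF measF (hpX i) (hpphiX^~ i)) => B FB.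
  have mXB : measurable (X t @^-1` [set i] `&` B).
    by apply: measurableI (measF _ FB); exact: (state_measurable hX).
  rewrite (measure_fibers P (regime_measurable hX) mXB).
  by apply: eq_bigr => k _; rewrite mul1e setIC setIA.
split=> [i|].
  apply: filterS pXXE => w pXXE pX0; apply/rowP => j.
  (* Left multiplication by a diagonal matrix scales rows, so the claim is [pXXE] divided by
     [pX i w]. *)
  rewrite !mxE summxE pXXE mulr_suml; apply: eq_bigr => k _.
  rewrite /switching_mx mul_diag_mx !mxE (hS i w).1//; ring.
apply: filterS pXE => w pXE; apply/matrixP => i j; rewrite summxE.
under eq_bigr do rewrite !mxE.
rewrite sumrMnl mxE; congr (_ *+ _).
(* Where [pX i w] is positive the weights sum to [pX i w / pX i w]; elsewhere, including where a
   version is negative, the completion supplies the sum 1. *)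
have [hpos hneg] := hS i w; have [pX0|/hneg[]//] := ltP 0 (pX i w).
under eq_bigr do rewrite hpos//.
rewrite -mulr_suml; under eq_bigr do rewrite -[pphiX _ _ _]mul1r.
by rewrite -pXE divff// gt_eqF.
Qed.
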